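(* Let $m,n\in\mathbb{N}$, let $\mathscr{A}\subseteq\mathbb{R}^{m\times n}$ be the set of all possible constraint coefficient matrices, let $b\in\mathbb{R}^m$, and let $g:\mathbb{R}^n\to\mathbb{R}$ be concave and $L$-Lipschitz. Assume that: (1) $\mathscr{A}$ is bounded, and its bounds are public (they do not depend on the sensitive matrix); (2) for every $A\in\mathscr{A}$ the set $\{x\in\mathbb{R}^n: Ax\le b\}$ has non-empty interior; (3) the set $\bigcap_{A\in\mathscr{A}}\{x: Ax\le b\}$ is non-empty. Fix an adjacency parameter $k>0$ and privacy parameters $\epsilon>0$, $\delta\in(0,\tfrac12)$. Then the Private Solution Algorithm (defined in the context), which takes a sensitive matrix $A\in\mathscr{A}$ as input and outputs a privacy-preserving solution $\tilde x^*$, keeps $A$ $(\epsilon,\delta)$-differentially private. That is, for all adjacent matrices $A,A'\in\mathscr{A}$ (adjacency as defined in the context, with parameter $k$) and all Borel sets $T\subseteq\mathbb{R}^n$, $$\mathbb{P}[\tilde x^*(A)\in T]\le e^{\epsilon}\,\mathbb{P}[\tilde x^*(A')\in T]+\delta,$$ where $\tilde x^*(A)$ denotes the random output of the algorithm on input $A$.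
   Context: Original problem: maximize $g(x)$ subject to $Ax\le b$, $x\ge 0$, where $A\in\mathscr{A}$ is sensitive and $g,b$ are public. Inequalities between vectors are componentwise. Adjacency: for $k>0$, two vectors $v,w\in\mathbb{R}^N$ are adjacent if there is an index $j\in\{1,\dots,N\}$ such that $v_i=w_i$ for all $i\ne j$, and $\|v-w\|_1\le k$. Matrices are compared as vectors of their entries. The zero entries of $A$ are public information and are not privatized, so adjacent matrices have the same positions of zero entries: $A,A'$ are adjacent if they have the same set of zero positions and they differ in at most one (non-zero) entry, by at most $k$ in absolute value. Truncated Laplace distribution $\mathcal{L}_T(\sigma,[-s,s])$: the probability distribution on $[-s,s]$ with density $f(z)=\frac1Z\exp(-|z|/\sigma)$ for $z\in[-s,s]$, where $Z$ is the normalizing constant. Private Solution Algorithm. Input: $g,b,\mathscr{A},\epsilon,\delta,k$ and $A=(a_{i,j})\in\mathscr{A}$. Set $\sigma=k/\epsilon$. For each row $i\in\{1,\dots,m\}$ let $n_i^0$ be the number of non-zero entries of row $i$ of $A$, and let $$s_i=\frac{k}{\epsilon}\log\!\left(\frac{n_i^0(e^\epsilon-1)}{\delta}+1\right)$$ ($\log$ is the natural logarithm). For each $(i,j)$ with $a_{i,j}\neq 0$, draw independent noise $z_{i,j}\sim\mathcal{L}_T(\sigma,[-s_i,s_i])$, set $\tilde a_{i,j}=a_{i,j}+s_i+z_{i,j}$, and then set $\bar a_{i,j}=\min\{\tilde a_{i,j},\ \sup_{B\in\mathscr{A}}B_{i,j}\}$. Form $\tilde A$ from $A$ by replacing each non-zero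 entry $a_{i,j}$ with $\bar a_{i,j}$ and leaving zero entries equal to zero. Finally, solve the problem: maximize $g(x)$ subject to $\tilde A x\le b$, $x\ge0$, by any algorithm (i.e. by a fixed Borel measurable map $h$ from $\tilde A$ to $\mathbb{R}^n$ returning a solution), and output the solution $\tilde x^*=h(\tilde A)$. *)

(* Defs.v *)
From HB Require Import structures.
From mathcomp Require Import all_boot all_order all_algebra.
From mathcomp Require Import all_classical all_reals all_analysis.

Set Implicit Arguments.
Unset Strict Implicit.
Unset Printing Implicit Defensive.

Import Order.TTheory GRing.Theory Num.Theory.
Import numFieldNormedType.Exports.

Local Open Scope classical_set_scope.
Local Open Scope ring_scope.

(* The matrix types carry the product topology, so for 'M[R]_(m, n) and
   'cV[R]_n this is the usual Borel sigma-algebra. *)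
Definition borel (T : ptopologicalType) : measurableType _ :=
  g_sigma_algebraType (@open T).

Definition polyhedron (R : realType) (m n : nat)
    (A : 'M[R]_(m, n)) (b : 'cV[R]_m) : set 'cV[R]_n :=
  [set x | forall i, (A *m x) i ord0 <= b i ord0].

Definition feasible (R : realType) (m n : nat)
    (A : 'M[R]_(m, n)) (b : 'cV[R]_m) : set 'cV[R]_n :=
  polyhedron A b `&` [set x | forall j, 0 <= x j ord0].

Definition optimal (R : realType) (m n : nat) (g : 'cV[R]_n -> R)
    (A : 'M[R]_(m, n)) (b : 'cV[R]_m) : set 'cV[R]_n :=
  [set x | feasible A b x /\ forall y, feasible A b y -> g y <= g x].

Definition concave (R : realType) (n : nat) (g : 'cV[R]_n -> R) : Prop :=
  convex_function setT (fun x => - g x).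

(* The norm `|x| on 'cV[R]_n is the sup norm, hence the explicit Euclidean
   distance. *)
Definition lipschitz2 (R : realType) (n : nat) (L : R) (g : 'cV[R]_n -> R)
    : Prop :=
  forall x y,
    `|g x - g y| <= L * Num.sqrt (\sum_j (x j ord0 - y j ord0) ^+ 2).

Definition adjacent_mx (R : realType) (m n : nat) (k : R)
    (A A' : 'M[R]_(m, n)) : Prop :=
  [/\ forall i j, (A i j == 0) = (A' i j == 0),
      exists i0 j0, forall i j, (i, j) != (i0, j0) -> A i j = A' i j &
      \sum_i \sum_j `|A i j - A' i j| <= k].

Definition trunc_laplace_mass (R : realType) (sigma s : R) : R :=
  \int[lebesgue_measure]_(z in `[- s, s]) expR (- (`|z| / sigma)).

Definition trunc_laplace_pdf (R : realType) (sigma s z : R) : R :=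
  if z \in `[- s, s] then
    expR (- (`|z| / sigma)) / trunc_laplace_mass sigma s
  else 0.

Definition trunc_laplace (R : realType) (sigma s : R) (U : set R) : \bar R :=
  (\int[lebesgue_measure]_(z in U) (trunc_laplace_pdf sigma s z)%:E)%E.

(* Choosing U i = setT for some of the indices gives the product rule for
   every subfamily. *)
Definition mutually_independent (R : realType) (d : measure_display)
    (Omega : measurableType d) (P : probability Omega R)
    (I : finType) (J : pred I) (X : I -> {RV P >-> R}) : Prop :=
  forall U : I -> set R, (forall i, measurable (U i)) ->
    P (\bigcap_(i in [set i | J i]) (X i @^-1` U i)) =
    (\prod_(i | J i) P (X i @^-1` U i))%E.

Definition row_nnz (R : realType) (m n : nat) (A : 'M[R]_(m, n)) (i : 'I_m)
    : nat := #|[pred j | A i j != 0]|.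

Definition noise_radius (R : realType) (m n : nat) (k eps delta : R)
    (A : 'M[R]_(m, n)) (i : 'I_m) : R :=
  k / eps * ln ((row_nnz A i)%:R * (expR eps - 1) / delta + 1).

Definition algorithm_noise (R : realType) (m n : nat) (k eps delta : R)
    (A : 'M[R]_(m, n)) (d : measure_display) (Omega : measurableType d)
    (P : probability Omega R) (Z : 'I_m * 'I_n -> {RV P >-> R}) : Prop :=
  (forall i j, A i j != 0 -> forall U : set R, measurable U ->
     distribution P (Z (i, j)) U =
     trunc_laplace (k / eps) (noise_radius k eps delta A i) U) /\
  mutually_independent (fun p => A p.1 p.2 != 0) Z.

Definition privatize (R : realType) (m n : nat) (Aset : set 'M[R]_(m, n))
    (k eps delta : R) (A : 'M[R]_(m, n)) (z : 'I_m * 'I_n -> R)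
    : 'M[R]_(m, n) :=
  \matrix_(i, j)
    if A i j == 0 then 0
    else Num.min (A i j + noise_radius k eps delta A i + z (i, j))
                 (sup [set B i j | B in Aset]).

(* The map h has to return a solution only on the privatized matrices that the
   algorithm can produce, and only when the privatized problem has one. *)
Definition solver (R : realType) (m n : nat) (g : 'cV[R]_n -> R)
    (b : 'cV[R]_m) (Aset : set 'M[R]_(m, n)) (k eps delta : R)
    (h : 'M[R]_(m, n) -> 'cV[R]_n) : Prop :=
  measurable_fun setT (h : borel 'M[R]_(m, n) -> borel 'cV[R]_n) /\
  forall (A : 'M[R]_(m, n)) (z : 'I_m * 'I_n -> R), Aset A ->
    (forall i j, A i j != 0 -> `|z (i, j)| <= noise_radius k eps delta A i) ->
    let M := privatize Aset k eps delta A z in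
    optimal g M b !=set0 -> optimal g M b (h M).

Definition private_solution (R : realType) (m n : nat)
    (Aset : set 'M[R]_(m, n)) (k eps delta : R)
    (h : 'M[R]_(m, n) -> 'cV[R]_n) (A : 'M[R]_(m, n))
    (d : measure_display) (Omega : measurableType d)
    (P : probability Omega R) (Z : 'I_m * 'I_n -> {RV P >-> R})
    (w : Omega) : 'cV[R]_n :=
  h (privatize Aset k eps delta A (fun p => Z p w)).

(* Main.v *)
(* Adjacent matrices have the same zero pattern, hence the same noise radii, and
   the privatized matrix of A is that of A' with the noise at the differing
   entry shifted by the difference c, |c| <= k. Conditioning on the other
   entries (Fubini, by independence) leaves a claim about one truncated Laplace
   variable. There the density ratio is at most e^eps where both densities live,
   and the rest is an interval of length |c| at one end of the support, whose
   mass the choice of the radius makes at most delta. The solver is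
   post-processing. *)
Require Import Defs.
From HB Require Import structures.
From mathcomp Require Import all_boot all_order all_algebra.
From mathcomp Require Import all_classical all_reals all_analysis.
From mathcomp Require Import measurable_realfun ring lra.

Set Implicit Arguments.
Unset Strict Implicit.
Unset Printing Implicit Defensive.

Import Order.TTheory GRing.Theory Num.Theory.
Import numFieldNormedType.Exports.

Local Open Scope classical_set_scope.
Local Open Scope ring_scope.

(** * Translation of Lebesgue integrals and integrals of exponentials *)

Lemma measurable_shift (R : realType) (c : R) :
  measurable_fun [set: R] (shift c).
Proof. exact: measurable_funD. Qed.

(** Lebesgue measure is determined by its values on half-open intervals, and a translation keeps
    their lengths. *)
Lemma lebesgue_measure_shift (R : realType) (c : R) (A : set R) :
  measurable A ->
  pushforward lebesgue_measure (shift c : R -> measurableTypeR R) A =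
  lebesgue_measure A.
Proof.
move=> mA; apply/esym/lebesgue_measure_unique => //=.
  exact: measurable_shift.
move=> mshift _ [[a b]] _ <- /=; rewrite /pushforward.
have -> : shift c @^-1` `]a, b]%classic = `](a - c), (b - c)]%classic.
  by apply/seteqP; split=> x /=; rewrite !in_itv/= ltrBlDr lerBrDr.
rewrite !lebesgue_measure_itv/= !lte_fin ltrD2r; case: ifP => // _.
by rewrite -!EFinB; congr EFin; ring.
Qed.

Lemma ge0_integral_shift (R : realType) (c : R) (D : set R) (f : R -> \bar R) :
  measurable D -> measurable_fun D f -> (forall x, D x -> 0 <= f x)%E ->
  (\int[lebesgue_measure]_(x in [set x | D (x + c)%R]) f (x + c)%R =
   \int[lebesgue_measure]_(x in D) f x)%E.
Proof.
move=> mD mf f0.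
transitivity (\int[pushforward lebesgue_measure
    (shift c : R -> measurableTypeR R)%R]_(x in D) f x)%E.
  rewrite ge0_integral_pushforward //; first exact: measurable_shift.
  by move=> x /[!inE]; exact: f0.
apply: eq_measure_integral; first exact: measurable_shift.
by move=> ? A mA _; exact: lebesgue_measure_shift.
Qed.

(** Fundamental theorem of calculus with primitive [expR (r * x) / r]. The case [a = b] is kept
    because a zero shift produces a degenerate tail interval. *)
Lemma integral_expRM (R : realType) (r a b : R) : r != 0 -> a <= b ->
  (\int[lebesgue_measure]_(x in `[a, b]) (expR (r * x))%:E =
   ((expR (r * b) - expR (r * a)) / r)%:E)%E.
Proof.
move=> r0; rewrite le_eqVlt => /predU1P[->|ab].
  by rewrite set_itv1 integral_set1 subrr mul0r.
have cexp : continuous (fun x : R^o => expR (r * x) : R^o).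
  by move=> x; apply/differentiable_continuous/derivable1_diffP/ex_derive.
have cF : continuous (fun x : R^o => expR (r * x) / r : R^o).
  by move=> x; apply/differentiable_continuous/derivable1_diffP/ex_derive.
rewrite (@continuous_FTC2 _ _ (fun x => expR (r * x) / r)) //.
- by rewrite mulrBl.
- exact: continuous_subspaceT.
- split.
  + by move=> x _; exact: ex_derive.
  + by apply/cvg_at_right_filter; exact: cF.
  + by apply/cvg_at_left_filter; exact: cF.
- move=> x _; rewrite derive1E derive_val.
  by rewrite /GRing.scale /= mulr0 add0r mulr1 mulrCA mulVf// mulr1.
Qed.

(** * The truncated Laplace distribution under a shift *)

Lemma measurable_expRN (R : realType) (sigma : R) :
  measurable_fun [set: R] (fun z : R => expR (- (`|z| / sigma))).
Proof.
apply: measurableT_comp; first exact: measurable_expR.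
by apply: measurable_funN; apply: measurable_funM.
Qed.

(** Only the half [[0, s]] of the support is integrated, where the absolute value disappears. This
    half of the mass already suffices for the tail estimate. *)
Lemma trunc_laplace_mass_ge (R : realType) (sigma s : R) :
  0 < sigma -> 0 <= s ->
  sigma * (1 - expR (- (s / sigma))) <= trunc_laplace_mass sigma s.
Proof.
move=> sigma0 s0; rewrite /trunc_laplace_mass /Rintegral.
set I := (\int[_]_(z in _) _)%E.
have mE D : measurable_fun D (fun z : R => (expR (- (`|z| / sigma)))%:E).
  by apply/measurable_EFinP; apply: measurable_funTS; exact: measurable_expRN.
(* The mass is the [fine] part of [I], so finiteness is required before comparing in the extended
   reals; the integrand is at most 1 on a bounded interval. *)
have Ifin : I \is a fin_num.
  rewrite ge0_fin_numE; last first.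
    by apply: integral_ge0 => z _; rewrite lee_fin expR_ge0.
  apply: (@le_lt_trans _ _ (\int[lebesgue_measure]_(z in `[(- s)%R, s]) 1)%E).
    apply: ge0_le_integral => //=.
    - exact: mE.
    - by move=> z _; rewrite lee_fin -expR0 ler_expR oppr_le0 divr_ge0// ltW.
  rewrite integral_cst//= mul1e lebesgue_measure_itv/=.
  by case: ifP => _; rewrite -?EFinB ltry.
rewrite -lee_fin fineK//.
have -> : ((sigma * (1 - expR (- (s / sigma))))%:E =
    \int[lebesgue_measure]_(x in `[0%R, s]) (expR (- sigma^-1 * x))%:E)%E.
  rewrite integral_expRM ?oppr_eq0 ?invr_eq0 ?gt_eqF//.
  rewrite mulr0 expR0 mulNr (mulrC sigma^-1); congr EFin; field.
  by rewrite gt_eqF.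
apply: (@le_trans _ _ (\int[lebesgue_measure]_(x in `[0%R, s])
    (expR (- (`|x| / sigma)))%:E)%E).
  rewrite le_eqVlt; apply/orP; left; apply/eqP; apply: eq_integral => x.
  by rewrite inE /= in_itv/= => /andP[x0 _]; rewrite ger0_norm// mulNr (mulrC x).
apply: ge0_subset_integral => //=; first exact: mE.
by move=> x /=; rewrite !in_itv/= => /andP[x0 ->]; rewrite andbT; lra.
Qed.

Lemma measurable_trunc_laplace_pdf (R : realType) (sigma s : R) :
  measurable_fun [set: R] (trunc_laplace_pdf sigma s).
Proof.
rewrite (_ : trunc_laplace_pdf sigma s = (fun z =>
    expR (- (`|z| / sigma)) * (trunc_laplace_mass sigma s)^-1 *
    \1_(`[- s, s]%classic) z)); last first.
  apply/funext => z; rewrite /trunc_laplace_pdf indicE mem_setE.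
  by case: ifP => _; rewrite ?mulr1 ?mulr0.
apply: measurable_funM; last exact: measurable_indic.
by apply: measurable_funM => //; exact: measurable_expRN.
Qed.

Lemma trunc_laplace_mass_ge0 (R : realType) (sigma s : R) :
  0 <= trunc_laplace_mass sigma s.
Proof. by apply: Rintegral_ge0 => z _; exact: expR_ge0. Qed.

Lemma trunc_laplace_pdf_ge0 (R : realType) (sigma s z : R) :
  0 <= trunc_laplace_pdf sigma s z.
Proof.
rewrite /trunc_laplace_pdf; case: ifP => // _.
by rewrite divr_ge0 ?expR_ge0 ?trunc_laplace_mass_ge0.
Qed.

(** The left side is the integral of [expR (- t / sigma)] over [[s - c, s]]. With
    [v = expR (s / sigma)], the lower bound on the mass leaves a gap of at least [sigma / v] times
    [delta * (v - 1) - (expR (c / sigma) - 1)], nonnegative by the condition on the radius. *)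
Lemma trunc_laplace_tail_le (R : realType) (sigma s c eps delta : R) :
  0 < sigma -> 0 < s -> 0 <= delta -> c <= sigma * eps ->
  expR eps - 1 <= delta * (expR (s / sigma) - 1) ->
  (expR ((c - s) / sigma) - expR (- (s / sigma))) * sigma <=
    delta * trunc_laplace_mass sigma s.
Proof.
move=> sigma0 s0 delta0 c_le eps_le.
apply: (le_trans _ (ler_wpM2l delta0 (trunc_laplace_mass_ge sigma0 (ltW s0)))).
rewrite [expR ((c - s) / sigma)](_ : _ = expR (c / sigma) / expR (s / sigma));
  last by rewrite mulrBl expRD expRN.
rewrite expRN.
set v := expR (s / sigma) in eps_le *.
have v0 : 0 < v by exact: expR_gt0.
have c_eps : expR (c / sigma) <= expR eps.
  by rewrite ler_expR ler_pdivrMr// mulrC.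
rewrite -subr_ge0.
rewrite (_ : _ - _ = sigma / v * (delta * (v - 1) - (expR (c / sigma) - 1))).
  by apply: mulr_ge0; [apply: divr_ge0; exact: ltW|lra].
by field; rewrite gt_eqF.
Qed.

(** The normalizing constants agree, and the exponents differ by at most [eps] by the triangle
    inequality. If [t] itself is outside the support, the left side is 0. *)
Lemma trunc_laplace_pdf_shift_le (R : realType) (sigma s c eps t : R) :
  0 < sigma -> `|c| <= sigma * eps -> - s <= t + c <= s ->
  trunc_laplace_pdf sigma s t <=
  expR eps * trunc_laplace_pdf sigma s (t + c).
Proof.
move=> sigma0 c_le tc; rewrite {2}/trunc_laplace_pdf in_itv /= tc.
rewrite /trunc_laplace_pdf; case: ifP => _; last first.
  by rewrite mulr_ge0 ?divr_ge0 ?expR_ge0 ?trunc_laplace_mass_ge0.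
rewrite mulrA -expRD ler_wpM2r ?invr_ge0 ?trunc_laplace_mass_ge0// ler_expR.
have : (`|t + c| - `|t|) / sigma <= eps.
  rewrite ler_pdivrMr// (mulrC eps).
  by apply: le_trans c_le; rewrite lerBlDl ler_normD.
by rewrite mulrBl; lra.
Qed.

(* Off the overlap [- s <= t + c <= s] the density is dominated by its
   exponential tail, which lives on an interval of length [`|c|]. *)
Lemma trunc_laplace_shift_le (R : realType) (sigma s c eps delta : R)
    (V : set R) :
  0 < sigma -> 0 < s -> 0 <= delta -> `|c| <= sigma * eps ->
  expR eps - 1 <= delta * (expR (s / sigma) - 1) -> measurable V ->
  (trunc_laplace sigma s [set t | V (t + c)%R] <=
   (expR eps)%:E * trunc_laplace sigma s V + delta%:E)%E.
Proof.
move=> sigma0 s0 delta0 c_le eps_le mV.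
pose mass := trunc_laplace_mass sigma s.
have mass0 : 0 < mass.
  apply: lt_le_trans (trunc_laplace_mass_ge sigma0 (ltW s0)).
  by rewrite mulr_gt0// subr_gt0 -expR0 ltr_expR oppr_lt0 divr_gt0.
have mU : measurable [set t | V (t + c)].
  by rewrite -[X in measurable X]setTI; exact: (measurable_shift c).
(* [[a, b]] holds the support points that the shift pushes out. There [expR (r * t)] dominates the
   Laplace exponential on either side of 0, so no case distinction on the size of the shift against
   [s] arises. *)
have [a [b [r [ab r0 tail_le tailE]]]] : exists a b r : R, [/\ a <= b, r != 0,
    forall t, trunc_laplace_pdf sigma s t <=
      expR eps * trunc_laplace_pdf sigma s (t + c) +
      expR (r * t) / mass * \1_(`[a, b]%classic) t &
    (expR (r * b) - expR (r * a)) / r / mass <= delta].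
  have tailP : (expR ((`|c| - s) / sigma) - expR (- (s / sigma))) * sigma / mass
      <= delta.
    by rewrite ler_pdivrMr// (@trunc_laplace_tail_le _ _ _ _ eps).
  have pdf_tail (a b r : R) : (forall t, - s <= t <= s ->
        ~~ (- s <= t + c <= s) -> t \in `[a, b] /\ - (`|t| / sigma) <= r * t) ->
      forall t, trunc_laplace_pdf sigma s t <=
        expR eps * trunc_laplace_pdf sigma s (t + c) +
        expR (r * t) / mass * \1_(`[a, b]%classic) t.
    move=> H t; have [tc|tc] := boolP (- s <= t + c <= s).
      apply: (le_trans (trunc_laplace_pdf_shift_le sigma0 c_le tc)).
      by rewrite lerDl mulr_ge0// divr_ge0 ?expR_ge0// ltW.
    apply: ler_wpDl; first by rewrite mulr_ge0 ?expR_ge0 ?trunc_laplace_pdf_ge0.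
    rewrite {1}/trunc_laplace_pdf in_itv/=; case: ifP => ts; last first.
      by rewrite mulr_ge0// divr_ge0 ?expR_ge0// ltW.
    have [tab tr] := H _ ts tc.
    rewrite indicE mem_setE tab mulr1; apply: ler_wpM2r.
      by rewrite invr_ge0 ltW.
    by rewrite ler_expR.
  have [c0|c0] := leP 0 c.
    (* A nonnegative shift loses points at the right end only. *)
    exists (s - c), s, (- sigma^-1); split.
    - by rewrite gerBl.
    - by rewrite oppr_eq0 invr_eq0 gt_eqF.
    - apply: pdf_tail => t /andP[st ts]; rewrite negb_and -!ltNge => /orP tc.
      split; first by rewrite in_itv/=; case: tc; lra.
      by rewrite mulNr (mulrC _ t) lerN2 ler_pM2r ?invr_gt0// ler_norm.
    - apply: le_trans tailP; rewrite ger0_norm// le_eqVlt; apply/orP; left.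
      apply/eqP; rewrite invrN invrK mulrN -mulNr opprB.
      by congr ((expR _ - expR _) * _ / _); field; rewrite gt_eqF.
  (* Mirror image: a negative shift loses points at the left end. *)
  exists (- s), (- s - c), (sigma^-1); split.
  - by rewrite lerBrDr gerDl ltW.
  - by rewrite invr_eq0 gt_eqF.
  - apply: pdf_tail => t /andP[st ts]; rewrite negb_and -!ltNge => /orP tc.
    split; first by rewrite in_itv/=; case: tc; lra.
    rewrite (mulrC _ t) -mulNr ler_pM2r ?invr_gt0//.
    by rewrite lerNl ler_normr lexx orbT.
  - apply: le_trans tailP; rewrite ltr0_norm// le_eqVlt; apply/orP; left.
    apply/eqP; rewrite invrK.
    by congr ((expR _ - expR _) * _ / _); field; rewrite gt_eqF.
pose tail t : \bar R := (expR (r * t) / mass * \1_(`[a, b]%classic) t)%:E.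
have tail_ge0 t : (0 <= tail t)%E.
  by rewrite lee_fin mulr_ge0// divr_ge0 ?expR_ge0// ltW.
have mexp : measurable_fun [set: R] (fun t => expR (r * t)).
  by apply: measurableT_comp; [exact: measurable_expR|exact: mulrl_measurable].
have mtail (D : set R) : measurable_fun D tail.
  apply: measurable_funTS; apply/measurable_EFinP.
  apply: measurable_funM; last exact: measurable_indic.
  exact: measurable_funM.
have mpdf (D : set R) : measurable_fun D (fun t => (trunc_laplace_pdf sigma s t)%:E).
  apply: measurable_funTS; apply/measurable_EFinP.
  exact: measurable_trunc_laplace_pdf.
have mpdfc (D : set R) : measurable_fun D
    (fun t : R => (trunc_laplace_pdf sigma s (t + c))%:E).
  apply: measurable_funTS; apply/measurable_EFinP.
  exact: (measurableT_comp (measurable_trunc_laplace_pdf _ _)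
    (measurable_shift c)).
have int_tail : (\int[lebesgue_measure]_t tail t <= delta%:E)%E.
  rewrite (_ : tail = (fun t => (mass^-1)%:E * (expR (r * t))%:E)%E
      \_ `[a, b]%classic); last first.
    apply/funext => t; rewrite /tail patchE indicE; case: ifP => _.
      by rewrite mulr1 -EFinM mulrC.
    by rewrite mulr0.
  rewrite -integral_mkcond ge0_integralZl_EFin//=.
  - by rewrite integral_expRM// -EFinM lee_fin mulrC.
  - by apply: measurable_funTS; apply/measurable_EFinP.
  - by rewrite invr_ge0 ltW.
rewrite /trunc_laplace.
apply: (@le_trans _ _ (\int[lebesgue_measure]_(t in [set t | V (t + c)%R])
   ((expR eps)%:E * (trunc_laplace_pdf sigma s (t + c)%R)%:E + tail t))%E).
  apply: ge0_le_integral => //=.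
  - by move=> t _; rewrite lee_fin trunc_laplace_pdf_ge0.
  - exact: mpdf.
  - apply: emeasurable_funD; last exact: mtail.
    by apply: measurable_funeM; exact: mpdfc.
  - by move=> t _; rewrite -EFinM -EFinD lee_fin.
rewrite ge0_integralD//=; last 3 first.
- by move=> t _; rewrite -EFinM lee_fin mulr_ge0 ?expR_ge0 ?trunc_laplace_pdf_ge0.
- by apply: measurable_funeM; exact: mpdfc.
- exact: mtail.
rewrite ge0_integralZl_EFin//=; last 2 first.
- by move=> t _; rewrite lee_fin trunc_laplace_pdf_ge0.
- exact: mpdfc.
have pdf_ge0 t : V t -> (0 <= (trunc_laplace_pdf sigma s t)%:E)%E.
  by move=> _; rewrite lee_fin trunc_laplace_pdf_ge0.
(* Translating by [c] turns the main term into the integral of the unshifted density over [V]; the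
   tail term is then enlarged to the whole line. *)
have -> := ge0_integral_shift c mV (mpdf V) pdf_ge0.
apply: leeD => //; apply: le_trans int_tail.
apply: ge0_subset_integral => //; exact: mtail.
Qed.

(** * Measurable structure on noise vectors and on matrices *)

(* Only the coordinates selected by [J] are observed: the noise at a zero entry
   of the matrix is unconstrained. *)
Definition box (R : realType) (I : finType) (J : pred I) (U : I -> set R)
  : set (I -> R) := [set z | forall i, J i -> U i (z i)].

Definition boxes (R : realType) (I : finType) (J : pred I)
  : set (set (I -> R)) :=
  [set box J U | U in [set U | forall i, measurable (U i)]].

(** This is the cylinder sigma-algebra of the coordinates in [J]; the other coordinates are in
    general not measurable for it. *)
Definition boxType (R : realType) (I : finType) (J : pred I)
  : measurableType _ := g_sigma_algebraType (@boxes R I J).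

Lemma box_setT (R : realType) (I : finType) (J : pred I) :
  box J (fun=> [set: R]) = setT.
Proof. by apply/seteqP; split. Qed.

Lemma boxes_setI_closed (R : realType) (I : finType) (J : pred I) :
  setI_closed (@boxes R I J).
Proof.
move=> _ _ [U mU <-] [V mV <-]; exists (fun i => U i `&` V i).
  by move=> i; apply: measurableI; [exact: mU|exact: mV].
apply/seteqP; split=> z; first by move=> H; split=> i /H[].
by move=> [HU HV] i Ji; split; [exact: HU|exact: HV].
Qed.

(** Boxes form a generating pi-system that contains the whole space, so Dynkin's uniqueness theorem
    applies with the constant cover [setT]. *)
Lemma eq_measure_boxes (R : realType) (I : finType) (J : pred I)
    (m1 m2 : {measure set (boxType R J) -> \bar R}) :
  (m1 setT < +oo)%E -> (forall U, (forall i, measurable (U i)) ->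
    m1 (box J U) = m2 (box J U)) ->
  forall E, measurable E -> m1 E = m2 E.
Proof.
move=> m1oo m12 E mE;
  apply: (@measure_unique _ R (boxType R J) (@boxes R I J) (fun=> setT)) => //.
- exact: boxes_setI_closed.
- by move=> _; exists (fun=> setT) => //; exact: box_setT.
- by apply/seteqP; split=> // z _; exists 0%N.
- by move=> _ [U mU <-]; exact: m12.
Qed.

Lemma measurable_coord (R : realType) (I : finType) (J : pred I) (i : I) :
  J i -> measurable_fun [set: boxType R J] (fun z : boxType R J => z i).
Proof.
move=> Ji _ U mU; rewrite setTI; apply: sub_sigma_algebra.
exists (fun j => if j == i then U else setT).
  by move=> j /=; case: ifP.
apply/seteqP; split=> z /=; first by move=> /(_ i Ji); rewrite eqxx.
by move=> Uz j _; case: eqP => // ->.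
Qed.

Lemma measurable_fun_boxType (R : realType) (I : finType) (J : pred I) d
    (T : measurableType d) (f : T -> boxType R J) :
  (forall i, J i -> measurable_fun setT (fun t => f t i)) ->
  measurable_fun setT f.
Proof.
move=> mf; apply: (@measurability _ _ T (boxType R J) setT f (@boxes R I J)) => //.
move=> _ [_ [U mU <-] <-]; rewrite setTI.
rewrite (_ : _ @^-1` _ =
    \bigcap_(i in [set i | J i]) ((fun t => f t i) @^-1` U i)) //.
apply: fin_bigcap_measurable => //.
by move=> i Ji; rewrite -[X in measurable X]setTI; exact: mf.
Qed.

(** Second countability: an open set of matrices is a countable union of balls with rational centre
    and radius, and membership in such a ball is a finite conjunction of conditions on entries. *)
Lemma measurable_fun_borel_mx (R : realType) (m n : nat) d
    (T : measurableType d) (f : T -> 'M[R]_(m, n)) :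
  (forall i j, measurable_fun setT (fun t => f t i j)) ->
  measurable_fun setT (f : T -> borel 'M[R]_(m, n)).
Proof.
move=> mf; apply: (@measurability _ _ T (borel 'M[R]_(m, n)) setT f
  (@open 'M[R]_(m, n))) => //.
move=> _ [V oV <-]; rewrite setTI.
pose B (q : 'M[rat]_(m, n) * rat) : set 'M[R]_(m, n) :=
  [set M : 'M[R]_(m, n) |
    forall i j, ball (ratr (q.1 i j) : R) (ratr q.2) (M i j)].
have mB q : measurable (f @^-1` B q).
  rewrite (_ : _ @^-1` _ = \bigcap_(p in [set: 'I_m * 'I_n])
      (fun t => f t p.1 p.2) @^-1` ball (ratr (q.1 p.1 p.2) : R) (ratr q.2)).
    apply: fin_bigcap_measurable => // p _.
    rewrite -[X in measurable X]setTI; apply: mf => //; exact: measurable_ball.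
  by apply/seteqP; split=> t Bt => [[i j] _|i j]; [exact: Bt|exact: (Bt (i, j))].
rewrite (_ : _ @^-1` _ =
    \bigcup_q (if `[< B q `<=` V >] then f @^-1` B q else set0)).
  apply: countable_bigcupT_measurable; first exact: countableP.
  by move=> q; case: ifP.
apply/seteqP; split=> t; last by move=> [q _]; case: asboolP => // qV /qV.
move=> Vt; have /nbhs_ballP[e /= e0 eV] := open_nbhs_nbhs (conj oV Vt).
(* Half of [e]: the rational centre lies within [r] of [f t], so every point of its ball is within
   [2 r < e] of [f t]. *)
have [r] := @rat_in_itvoo _ 0 (e / 2) ltac:(by rewrite divr_gt0).
rewrite in_itv/= => /andP[r0 re].
have approx i j : exists q, ball (f t i j) (ratr r) (ratr q).
  have [q] := @rat_in_itvoo _ (f t i j - ratr r) (f t i j + ratr r)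
    ltac:(by rewrite ltrBlDr -addrA ltrDl addr_gt0).
  rewrite in_itv/= => qP; exists q.
  by rewrite -ball_normE /ball_/= ltr_distl; move: qP => /andP[]; lra.
pose q := (\matrix_(i, j) projT1 (cid (approx i j)), r).
have qE i j : ball (f t i j) (ratr r) (ratr (q.1 i j)).
  by rewrite mxE; exact: (projT2 (cid (approx i j))).
exists q => //; case: asboolP => [_ i j|]; first exact/ball_sym/qE.
case=> M BM; apply: eV; split=> // i j.
apply: (@le_ball _ _ _ (ratr r + ratr r)); first by lra.
by apply: ball_triangle (qE i j) (BM i j).
Qed.

(** * Conditioning a product law on all coordinates but one *)

Definition set_coord (R : realType) (I : finType) (p : I) (t : R) (z : I -> R)
  : I -> R := fun i => if i == p then t else z i.

Lemma measurable_set_coord (R : realType) (I : finType) (J : pred I) (p : I) :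
  measurable_fun [set: R * boxType R J]
    (fun x => set_coord p x.1 x.2 : boxType R J).
Proof.
apply: measurable_fun_boxType => i Ji; rewrite /set_coord.
have [_|_] := eqVneq i p; first exact: measurable_fst.
exact: (measurableT_comp (measurable_coord Ji) measurable_snd).
Qed.

Section product_law.
Context (R : realType) (I : finType) (J : pred I).
Context (lam : I -> probability R R) (mu : probability (boxType R J) R).
Hypothesis mu_box : forall U, (forall i, measurable (U i)) ->
  mu (box J U) = (\prod_(i | J i) lam i (U i))%E.

(** Overwriting coordinate [p] by a fresh independent draw from [lam p] preserves [mu], since both
    laws give the same value to every box. The integral is the law after overwriting, computed by
    sections. *)
Lemma product_law_set_coord (p : I) (E : set (boxType R J)) : J p ->
  measurable E ->
  mu E = (\int[mu]_z lam p [set t | E (set_coord p t z)])%E.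
Proof.
move=> Jp mE; pose Phi (x : R * boxType R J) : boxType R J :=
  set_coord p x.1 x.2.
have mPhi : measurable_fun setT Phi by exact: measurable_set_coord.
pose mPhi_mixin := isMeasurableFun.Build _ _ _ _ _ mPhi.
pose PhiM : {mfun _ >-> _} := HB.pack Phi mPhi_mixin.
rewrite (@eq_measure_boxes _ _ _ mu (distribution (lam p \x^ mu)%E PhiM)) //.
- rewrite /distribution /pushforward /product_measure2.
  apply: eq_integral => z _ /=; congr (lam p _).
  by apply/seteqP; split=> t; rewrite /ysection /= inE.
- by rewrite [X in (X < _)%E](probability_setT mu) ltry.
move=> U mU.
(* The old value at [p] is forgotten, so its constraint moves to the fresh draw and leaves a factor
   [lam p setT = 1]. *)
pose V i := if i == p then setT else U i.
have mV i : measurable (V i) by rewrite /V; case: ifP.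
rewrite /distribution /pushforward /=.
rewrite (_ : Phi @^-1` _ = U p `*` box J V); last first.
  apply/seteqP; split=> -[t z]; rewrite /Phi /box /V /set_coord/=.
    move=> H; split; first by have := H p Jp; rewrite eqxx.
    by move=> i Ji; have := H i Ji; case: eqP.
  move=> [Ut H] i Ji; have := H i Ji.
  by case: eqP => // ->.
have mbox : measurable (box J V : set (boxType R J)).
  by apply: sub_sigma_algebra; exists V.
rewrite product_measure2E// [X in (_ * X)%E](mu_box mV) (mu_box mU).
rewrite (bigD1 p)//=; congr (_ * _)%E.
rewrite [RHS](bigD1 p)//= {1}/V eqxx probability_setT mul1e.
by apply: eq_bigr => i /andP[_ /negPf ip]; rewrite /V ip.
Qed.

(** With the other coordinates fixed, the section of the shifted event is the translate by [c] of
    the section of [E]. The one-dimensional bound applies to each section and is integrated over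
    [mu], whose total mass 1 keeps [delta] unchanged. *)
Lemma product_law_shift_le (p : I) (c C delta : R) (E : set (boxType R J)) :
  J p -> 0 <= C -> 0 <= delta -> measurable E ->
  (forall V : set R, measurable V ->
     (lam p [set t | V (t + c)%R] <= C%:E * lam p V + delta%:E)%E) ->
  (mu [set z | E (set_coord p (z p + c)%R z)] <= C%:E * mu E + delta%:E)%E.
Proof.
move=> Jp C0 delta0 mE lam_le.
have msection z : measurable [set t | E (set_coord p t z)].
  have mz : measurable_fun [set: R] (fun t => (t, z) : R * boxType R J).
    exact: measurable_pair2.
  rewrite -[X in measurable X]setTI.
  exact: (measurableT_comp (@measurable_set_coord R I J p) mz).
have mE' : measurable [set z : boxType R J | E (set_coord p (z p + c) z)].
  rewrite -[X in measurable X]setTI.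
  have mz : measurable_fun setT
      (fun z : boxType R J => (z p + c, z) : R * boxType R J).
    apply: measurable_fun_pair => //=.
    exact: (measurableT_comp (measurable_shift c) (measurable_coord Jp)).
  exact: (measurableT_comp (@measurable_set_coord R I J p) mz).
have mlam (F : set (boxType R J)) : measurable F -> measurable_fun setT
    (fun z : boxType R J => lam p [set t | F (set_coord p t z)]).
  move=> mF; pose G := (fun x : R * boxType R J =>
    set_coord p x.1 x.2 : boxType R J) @^-1` F.
  have mG : measurable G.
    rewrite -[X in measurable X]setTI.
    exact: (@measurable_set_coord R I J p).
  rewrite (_ : (fun z => _) = lam p \o ysection G).
    exact: measurable_fun_ysection.
  apply/funext => z /=; congr (lam p _).
  by apply/seteqP; split=> t; rewrite /ysection /= inE.
rewrite !(product_law_set_coord Jp)//.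
apply: (@le_trans _ _ (\int[mu]_z (C%:E * lam p [set t | E (set_coord p t z)]
    + (cst delta%:E z)))%E).
  apply: ge0_le_integral => //=.
  - exact: mlam mE'.
  - apply: emeasurable_funD; last exact: measurable_cst.
    by apply: measurable_funeM; exact: mlam mE.
  - move=> z _; apply: le_trans (lam_le _ (msection z)).
    rewrite le_eqVlt; apply/orP; left; apply/eqP; congr (lam p _).
    (* The second overwriting of [p] erases the first, and the value it reads at [p] is [t]. *)
    apply/seteqP; split=> t /=; rewrite (_ : set_coord p _ (set_coord p t z) =
        set_coord p (t + c) z) //; apply/funext => i;
      by rewrite /set_coord eqxx; case: eqP.
rewrite ge0_integralD//=; last 2 first.
- by move=> z _; rewrite mule_ge0.
- by apply: measurable_funeM; exact: mlam mE.
rewrite ge0_integralZl_EFin//; last exact: mlam mE.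
rewrite integral_cst//= [X in (_ + _ * X)%E](probability_setT mu) mule1.
exact: lexx.
Qed.
End product_law.

(** * The privatized matrix and the joint law of its noise *)

Lemma measurable_privatize (R : realType) (m n : nat) (Aset : set 'M[R]_(m, n))
    (k eps delta : R) (A : 'M[R]_(m, n)) :
  measurable_fun setT
    (privatize Aset k eps delta A :
       boxType R (fun p : 'I_m * 'I_n => A p.1 p.2 != 0) -> borel 'M[R]_(m, n)).
Proof.
apply: measurable_fun_borel_mx => i j.
(* At a zero entry the noise coordinate is outside the observed ones, but the privatized entry is
   the constant 0. *)
have [Aij0|Aij] := eqVneq (A i j) 0.
  rewrite [X in measurable_fun _ X](_ : _ = cst (0 : R)).
    exact: measurable_cst.
  by apply/funext => z; rewrite mxE Aij0 eqxx.
rewrite [X in measurable_fun _ X](_ : _ = (fun z : 'I_m * 'I_n -> R =>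
    A i j + noise_radius k eps delta A i + z (i, j)) \min
    cst (sup [set B i j | B in Aset])); last first.
  by apply/funext => z; rewrite mxE (negPf Aij).
apply: measurable_minr; last exact: measurable_cst.
apply: measurable_funD; first exact: measurable_cst.
exact: measurable_coord.
Qed.

(** Passing to the law on noise vectors makes runs on different probability spaces comparable;
    independence is exactly the product formula on boxes. *)
Lemma joint_law (R : realType) (I : finType) (J : pred I) d
    (Omega : measurableType d) (P : probability Omega R)
    (Z : I -> {RV P >-> R}) :
  mutually_independent J Z ->
  exists2 mu : probability (boxType R J) R,
    forall E, mu E = P [set w | E (fun i => Z i w)] &
    forall U, (forall i, measurable (U i)) ->
      mu (box J U) = (\prod_(i | J i) distribution P (Z i) (U i))%E.
Proof.
move=> indep; pose X w : boxType R J := fun i => Z i w.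
have mX : measurable_fun setT X.
  by apply: measurable_fun_boxType => i _; exact: measurable_funP.
pose mX_mixin := isMeasurableFun.Build _ _ _ _ _ mX.
pose XM : {RV P >-> boxType R J} := HB.pack X mX_mixin.
by exists (distribution P XM) => // U mU; rewrite -indep.
Qed.

(** * Comparison of adjacent matrices *)

Section adjacent.
Context (R : realType) (m n : nat) (Aset : set 'M[R]_(m, n)).
Context (k eps delta : R) (A A' : 'M[R]_(m, n)).
Hypothesis eq_supp : forall i j, (A i j == 0) = (A' i j == 0).

Lemma noise_radius_supp i :
  noise_radius k eps delta A i = noise_radius k eps delta A' i.
Proof.
rewrite /noise_radius (_ : row_nnz A i = row_nnz A' i)//.
by apply: eq_card => j; rewrite !inE eq_supp.
Qed.

Lemma algorithm_noise_supp d (Omega : measurableType d)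
    (P : probability Omega R) (Z : 'I_m * 'I_n -> {RV P >-> R}) :
  algorithm_noise k eps delta A' Z -> algorithm_noise k eps delta A Z.
Proof.
rewrite /algorithm_noise => -[law indep]; split.
  by move=> i j; rewrite eq_supp noise_radius_supp; exact: law.
by rewrite (_ : (fun p => _) = (fun p => A' p.1 p.2 != 0))//; apply/funext => p;
  rewrite eq_supp.
Qed.

(** At the differing entry, [a + s + z = a' + s + (z + (a - a'))]. The clipping level depends only
    on [Aset] and the position, so clipping preserves the equality. *)
Lemma privatize_shift i0 j0 z : A i0 j0 != 0 ->
  (forall i j, (i, j) != (i0, j0) -> A i j = A' i j) ->
  privatize Aset k eps delta A z = privatize Aset k eps delta A'
    (set_coord (i0, j0) (z (i0, j0) + (A i0 j0 - A' i0 j0)) z).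
Proof.
move=> A0 AA'; apply/matrixP => i j; rewrite !mxE eq_supp noise_radius_supp.
case: ifP => // _; congr Num.min; rewrite /set_coord.
by have [[-> ->]|ij] := eqVneq; [ring|rewrite AA'].
Qed.

End adjacent.

(** By the choice of the logarithm the right side equals [N * (expR eps - 1)], with [N] the number
    of non-zero entries of the row; [N >= 1] because entry [j] is one of them. *)
Lemma noise_radius_bounds (R : realType) (m n : nat) (k eps delta : R)
    (A : 'M[R]_(m, n)) i j : 0 < k -> 0 < eps -> 0 < delta -> A i j != 0 ->
  0 < noise_radius k eps delta A i /\
  expR eps - 1 <=
    delta * (expR (noise_radius k eps delta A i / (k / eps)) - 1).
Proof.
move=> k0 eps0 delta0 Aij.
have N1 : 1 <= (row_nnz A i)%:R :> R.
  by rewrite ler1n; apply/card_gt0P; exists j; rewrite inE.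
have e1 : 0 < expR eps - 1 by rewrite subr_gt0 -expR0 ltr_expR.
have x0 : 0 < (row_nnz A i)%:R * (expR eps - 1) / delta.
  by rewrite divr_gt0// mulr_gt0// (lt_le_trans ltr01).
rewrite /noise_radius; split.
  by rewrite mulr_gt0 ?divr_gt0// ln_gt0// ltrDr.
rewrite mulrAC divff ?mul1r ?gt_eqF ?divr_gt0// lnK; last first.
  by rewrite posrE addr_gt0.
by rewrite addrK mulrC divfK ?gt_eqF// ler_peMl// ltW.
Qed.

Lemma adjacent_entry_le (R : realType) (m n : nat) (k : R)
    (A A' : 'M[R]_(m, n)) i j : adjacent_mx k A A' -> `|A i j - A' i j| <= k.
Proof.
case=> _ _; apply: le_trans.
rewrite (bigD1 i)//= (bigD1 j)//= -addrA lerDl addr_ge0 ?sumr_ge0// => i' _.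
by rewrite sumr_ge0.
Qed.

Theorem theorem1 (R : realType) (m n : nat) (Aset : set 'M[R]_(m, n))
    (b : 'cV[R]_m) (g : 'cV[R]_n -> R) (L : R)
    (g_concave : concave g) (g_lipschitz : lipschitz2 L g)
    (Aset_bounded : bounded_set Aset)
    (interior_nonempty : forall A, Aset A -> (polyhedron A b)° !=set0)
    (bigcap_nonempty : \bigcap_(A in Aset) polyhedron A b !=set0)
    (k eps delta : R) (k_gt0 : 0 < k) (eps_gt0 : 0 < eps)
    (delta_gt0 : 0 < delta) (delta_lt : delta < 1 / 2)
    (h : 'M[R]_(m, n) -> 'cV[R]_n)
    (h_solver : solver g b Aset k eps delta h)
    (A A' : 'M[R]_(m, n)) (A_in : Aset A) (A'_in : Aset A')
    (AA'_adjacent : adjacent_mx k A A')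
    (d : measure_display) (Omega : measurableType d)
    (P : probability Omega R) (Z : 'I_m * 'I_n -> {RV P >-> R})
    (Z_noise : algorithm_noise k eps delta A Z)
    (d' : measure_display) (Omega' : measurableType d')
    (P' : probability Omega' R) (Z' : 'I_m * 'I_n -> {RV P' >-> R})
    (Z'_noise : algorithm_noise k eps delta A' Z')
    (T : set 'cV[R]_n) (T_borel : measurable (T : set (borel 'cV[R]_n))) :
  (P (private_solution Aset k eps delta h A Z @^-1` T) <=
   (expR eps)%:E *
     P' (private_solution Aset k eps delta h A' Z' @^-1` T) + delta%:E)%E.
Proof.
have [eq_supp [i0 [j0 AA'_eq]] _] := AA'_adjacent.
set J := fun p : 'I_m * 'I_n => A p.1 p.2 != 0.
have [law indep] := Z_noise.
have [law' indep'] := algorithm_noise_supp eq_supp Z'_noise.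
have [mu muE mu_box] := joint_law indep.
have [mu' mu'E mu'_box] := joint_law indep'.
(* Both output events are expressed through this one set of noise vectors: directly for [A'], after
   a shift for [A]. *)
pose E : set (boxType R J) := [set z | T (h (privatize Aset k eps delta A' z))].
have mE : measurable E.
  have [mh _] := h_solver.
  have mpriv : measurable_fun setT (privatize Aset k eps delta A' :
      boxType R J -> borel 'M[R]_(m, n)).
    rewrite (_ : J = (fun p => A' p.1 p.2 != 0)); last first.
      by apply/funext => p; rewrite /J eq_supp.
    exact: measurable_privatize.
  rewrite -[X in measurable X]setTI.
  exact: (measurableT_comp mh mpriv).
(* Equal radii give equal marginals, so the two joint laws agree on boxes and hence everywhere. *)
have mu'_mu : mu' E = mu E.
  apply: eq_measure_boxes => // [|U mU].
    by rewrite [X in (X < _)%E](probability_setT mu') ltry.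
  rewrite [LHS]mu'_box// [RHS]mu_box//; apply: eq_bigr => -[i j] Aij.
  by rewrite law// law'.
rewrite (_ : P' _ = mu E); last by rewrite -mu'_mu mu'E.
(* If the exceptional entry is zero, it is zero in both matrices, so [A = A'] and [1 <= expR eps] is
   enough. *)
have [A0|A0] := eqVneq (A i0 j0) 0.
  have <- : mu E = P (private_solution Aset k eps delta h A Z @^-1` T).
    rewrite muE /private_solution (_ : A = A')//; apply/matrixP => i j.
    have [[-> ->]|/AA'_eq //] := eqVneq (i, j) (i0, j0).
    by rewrite A0; apply/esym/eqP; rewrite -eq_supp A0.
  rewrite -[X in (X <= _)%E]adde0; apply: leeD; last by rewrite lee_fin ltW.
  rewrite -[X in (X <= _)%E]mul1e lee_wpmul2r// lee_fin.
  by rewrite -expR0 ler_expR ltW.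
have -> : P (private_solution Aset k eps delta h A Z @^-1` T) =
    mu [set z | E (set_coord (i0, j0) (z (i0, j0) + (A i0 j0 - A' i0 j0)) z)].
  rewrite muE; congr (P _); apply/seteqP.
  by split=> w; rewrite /E /private_solution /= -privatize_shift.
apply: (product_law_shift_le mu_box) => //; first exact: ltW.
move=> V mV.
have [s0 eps_le] := noise_radius_bounds k_gt0 eps_gt0 delta_gt0 A0.
have mVc : measurable [set t | V (t + (A i0 j0 - A' i0 j0))].
  by rewrite -[X in measurable X]setTI; exact: measurable_shift.
rewrite /= !law//; apply: trunc_laplace_shift_le => //.
- exact: divr_gt0.
- exact: ltW.
(* The scale is [k / eps], so the permitted shift [sigma * eps] is [k]. *)
- by rewrite divfK ?gt_eqF// adjacent_entry_le.
Qed.
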